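(* Let $G$ be a finite group, $G^0\subset G$ a subgroup of index $2$, and view $G$ as a subgroup of $G^0(2)$ as described in the context. For every subgroup $G'$ of $G^0(2)$ containing $G$, define the subgroup $K\subset G^0$ by $K\times\{1\}:=G'\cap\left(G^0\times\{1\}\right)$. Then $K$ is normal in $G$. Moreover $K$ determines $G'$, in the sense that for every subgroup $K$ of $G^0$ that is normal in $G$ there is a unique group $G_K$ with $G\subset G_K\subset G^0(2)$ such that $G_K\cap\left(G^0\times\{1\}\right)=K\times\{1\}$.
   Context: For a group $H$, $H(2)$ denotes the semidirect product $(H\times H)\rtimes \mathbb{Z}/2\mathbb{Z}$, where a generator $\sigma$ of $\mathbb{Z}/2\mathbb{Z}$ acts by $\sigma(h_1,h_2)\sigma^{-1}=(h_2,h_1)$. For $g\in G$ write $\mathrm{Ad}_g(h)=ghg^{-1}$. Let $1\to G^0\to G\to\mathbb{Z}/2\mathbb{Z}\to 1$ be an extension of finite groups. Fix once and for all $\tau'\in G\setminus G^0$ and set $\tau:=(\tau')^2\in G^0$. There is an injective homomorphism $G\hookrightarrow G^0(2)$ given by $$\tau'\mapsto \sigma(\tau,1)=(1,\tau)\sigma,\qquad g\mapsto (g,\mathrm{Ad}_{\tau'}(g))\ \text{ for all } g\in G^0,$$ and $G$ is identified with its image in $G^0(2)$ via this homomorphism. The normality of $K\subset G^0$ in $G$ refers to $K$ as a subgroup of the abstract group $G$ via $K\subset G^0\subset G$. *)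

(* Defs.v *)
From mathcomp Require Import all_boot all_fingroup.
From mathcomp Require Import zmodp.

Set Implicit Arguments.
Unset Strict Implicit.
Unset Printing Implicit Defensive.

Import GroupScope.

Section Double.

Variable gT : finGroupType.

Definition Ad (g h : gT) : gT := g * h * g^-1.

(* 'Z_2 is used here as a finGroupType, hence written multiplicatively. *)
Definition swap (p : gT * gT) (a : 'Z_2) : gT * gT :=
  if a == 1 then p else (p.2, p.1).

Lemma swap_id p : swap p 1 = p.
Proof. by []. Qed.

Lemma swapM p a b : swap p (a * b) = swap (swap p a) b.
Proof. by case: p a b => x y [[|[|//]] ia] [[|[|//]] ib]. Qed.

Canonical swap_action := TotalAction swap_id swapM.

Lemma swap_is_groupAction : is_groupAction [set: gT * gT] swap_action.
Proof.
move=> a _; rewrite /= inE; apply/andP; split.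
  by apply/subsetP=> x _; rewrite inE.
apply/morphicP=> x y _ _; rewrite !actpermE /= /swap.
by case: (a == 1).
Qed.

Canonical swap_groupAction := GroupAction swap_is_groupAction.

Definition dblT : finGroupType := sdprod_by swap_groupAction.

Definition dpair (p : gT * gT) : dblT := sdpair1 swap_groupAction p.

Definition dsigma : dblT := sdpair2 swap_groupAction Zp1.

(* H(2) for a subgroup H of gT, inside the semidirect product dblT = gT(2). *)
Definition dbl (H : {set gT}) : {set dblT} :=
  dpair @: setX H H * [set 1; dsigma].

(* K x {1}, viewed in dblT *)
Definition dleft (K : {set gT}) : {set dblT} := [set dpair (k, 1) | k in K].

(* The embedding determined by t = tau': when G0 has index 2 in G, the elements
   of G outside G0 are the t * g with g in G0.  The values outside G are
   irrelevant. *)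
Definition embed (G0 : {set gT}) (t x : gT) : dblT :=
  if x \in G0 then dpair (x, Ad t x)
  else let g := t^-1 * x in dsigma * dpair (t ^+ 2, 1) * dpair (g, Ad t g).

Lemma dpairM p q : dpair (p * q) = dpair p * dpair q.
Proof. by rewrite /dpair sdpair1_morphM ?inE. Qed.

Lemma dpair1 : dpair 1 = 1.
Proof. exact: (morph1 (sdpair1_morphism swap_groupAction)). Qed.

Lemma dpair_inj : injective dpair.
Proof.
move=> p q; apply: (injmP (injm_sdpair1 swap_groupAction)); exact: in_setT.
Qed.

Lemma dsigma2 : dsigma * dsigma = 1.
Proof.
rewrite /dsigma -sdpair2_morphM ?inE // (_ : Zp1 * Zp1 = 1) //.
  exact: (morph1 (sdpair2_morphism swap_groupAction)).
exact: val_inj.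
Qed.

Lemma dsigmaV : dsigma^-1 = dsigma.
Proof. by apply: (mulgI dsigma); rewrite mulgV dsigma2. Qed.

Lemma dsigmaJ h1 h2 : dsigma * dpair (h1, h2) * dsigma^-1 = dpair (h2, h1).
Proof.
have := sdpair_act swap_groupAction
  (in_setT (h1, h2)) (in_setT (Zp1 : 'Z_2)).
by rewrite /conjg mulgA -/dsigma dsigmaV => <-.
Qed.

Lemma dsigmaE p : dsigma * dpair p = dpair (p.2, p.1) * dsigma.
Proof. by case: p => x y; rewrite -(dsigmaJ x y) mulgVK. Qed.

Lemma dpair_sigma p : dpair p * dsigma = dsigma * dpair (p.2, p.1).
Proof. by rewrite dsigmaE; case: p. Qed.

Lemma dpair_neq_dsigma p q : dpair p != dsigma * dpair q.
Proof.
have neq r : dpair r != dsigma.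
  apply/eqP=> /(congr1 (fun u : dblT => val u)).
  by rewrite /dpair /dsigma /= !val_insubd !inE.
apply/eqP=> e; have /eqP[] := neq (p * q^-1); rewrite dpairM e.
by rewrite -mulgA -dpairM mulgV dpair1 mulg1.
Qed.

Lemma dpair_morphimE (A : {set gT * gT}) :
  sdpair1 swap_groupAction @* A = dpair @: A.
Proof. by rewrite morphimEsub ?subsetT. Qed.

Lemma sdpair2_morphimT :
  sdpair2 swap_groupAction @* setT_group _ = [set 1; dsigma].
Proof.
rewrite morphimEdom; apply/setP=> u; rewrite !inE.
apply/imsetP/orP=> [[[[|[|//]] ia] _ ->]|[/eqP->|/eqP->]].
- by left; apply/eqP; rewrite -(morph1 [morphism of sdpair2 swap_groupAction]);
    congr sdpair2; apply: val_inj.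
- by right; apply/eqP; congr sdpair2; apply: val_inj.
- by exists 1; rewrite ?inE ?morph1.
- by exists Zp1; rewrite ?inE.
Qed.

Lemma dsigma_norm (H : {group gT}) :
  sdpair2 swap_groupAction @* setT_group _ \subset
    'N(sdpair1 swap_groupAction @* setX H H).
Proof.
apply/subsetP=> u; rewrite /= sdpair2_morphimT.
case/set2P=> ->; first exact: group1.
rewrite inE dpair_morphimE; apply/subsetP=> v; rewrite mem_conjg.
case/imsetP=> -[x y] /setXP[Hx Hy] e; apply/imsetP; exists (y, x).
  exact/setXP.
rewrite -dsigmaJ -e conjgE !dsigmaV !mulgA dsigma2 mul1g.
by rewrite -mulgA dsigma2 mulg1.
Qed.

Lemma dbl_sdprod (H : {group gT}) :
  sdpair1 swap_groupAction @* setX H H ><|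
    sdpair2 swap_groupAction @* setT_group _ = dbl H.
Proof.
rewrite /dbl -dpair_morphimE -sdpair2_morphimT.
apply: sdprodE; first exact: dsigma_norm.
apply/trivgP; rewrite -(im_sdpair_TI swap_groupAction) setSI // morphimS //.
exact: subsetT.
Qed.

Lemma dbl_group_set (H : {group gT}) : group_set (dbl H).
Proof.
rewrite /dbl -dpair_morphimE -sdpair2_morphimT -norm_joinEr ?groupP //.
exact: dsigma_norm.
Qed.

Canonical dbl_group H := Group (dbl_group_set H).

Section Embedding.

Variables (G G0 : {group gT}) (t : gT).
Hypotheses (sG0G : G0 \subset G) (iG0 : #|G : G0| = 2) (Gt : t \in G :\: G0).

Lemma embed_in g : g \in G0 -> embed G0 t g = dpair (g, Ad t g).
Proof. by rewrite /embed => ->. Qed.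

Lemma embed_notin x :
  x \notin G0 -> embed G0 t x = dsigma * dpair (t * x, x * t^-1).
Proof.
rewrite /embed => /negPf->; rewrite -mulgA -dpairM; congr (_ * dpair (_, _)).
  by rewrite expgS expg1 /= -mulgA mulKVg.
by rewrite /= mul1g /Ad mulKVg.
Qed.

Lemma embed_tau : embed G0 t t = dsigma * dpair (t ^+ 2, 1).
Proof. by case/setDP: Gt => _ /embed_notin->; rewrite mulgV. Qed.

Lemma embed_tau' : embed G0 t t = dpair (1, t ^+ 2) * dsigma.
Proof. by rewrite embed_tau dsigmaE. Qed.

Lemma index2_mulG x y : x \in G -> y \in G ->
  (x * y \in G0) = ((x \in G0) == (y \in G0)).
Proof.
move=> Gx Gy; have [G0x | G0'x] := boolP (x \in G0).
  by rewrite groupMl // eqb_id.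
have [G0y | G0'y] := boolP (y \in G0); first by rewrite groupMr // (negPf G0'x).
have sx : x^-1 *: G0 \subset G :\: G0.
  apply/subsetP=> _ /lcosetP[g G0g ->]; rewrite inE groupMr // groupV G0'x.
  by rewrite groupM ?groupV // (subsetP sG0G).
have : y \in x^-1 *: G0.
  suff -> : x^-1 *: G0 = G :\: G0 by rewrite inE G0'y.
  apply/eqP; rewrite eqEcard sx cardsD (setIidPr sG0G) card_lcoset.
  by rewrite -(Lagrange sG0G) iG0 muln2 -addnn addnK leqnn.
by case/lcosetP=> g G0g ->; rewrite mulKVg G0g.
Qed.

Lemma embedM : {in G &, {morph embed G0 t : x y / x * y}}.
Proof.
move=> x y Gx Gy; have Gxy := index2_mulG Gx Gy.
have [G0x | G0'x] := boolP (x \in G0); have [G0y | G0'y] := boolP (y \in G0).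
- rewrite !embed_in ?groupM // -dpairM; congr dpair; congr (_, _).
  by rewrite /Ad /= !mulgA mulgVK.
- rewrite (embed_in G0x) !embed_notin ?groupMl // [RHS]mulgA.
  rewrite dpair_sigma -[RHS]mulgA -dpairM.
  by congr (_ * dpair (_, _)); rewrite /Ad /= !mulgA ?mulgVK.
- rewrite (embed_in G0y) !embed_notin ?groupMr // -[RHS]mulgA -dpairM.
  by congr (_ * dpair (_, _)); rewrite /Ad /= !mulgA ?mulgVK.
rewrite embed_in ?Gxy ?(negPf G0'x) ?(negPf G0'y) // !embed_notin //.
rewrite [RHS]mulgA -[_ * _ * dsigma]mulgA dpair_sigma mulgA dsigma2 mul1g -dpairM.
by congr dpair; congr (_, _); rewrite /Ad /= !mulgA ?mulgVK.
Qed.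

Lemma embed_inj : {in G &, injective (embed G0 t)}.
Proof.
move=> x y Gx Gy.
have [G0x | G0'x] := boolP (x \in G0); have [G0y | G0'y] := boolP (y \in G0).
- by rewrite !embed_in // => /dpair_inj[].
- rewrite embed_in // embed_notin // => e.
  by have := dpair_neq_dsigma (x, Ad t x) (t * y, y * t^-1); rewrite e eqxx.
- rewrite (embed_in G0y) embed_notin // => e.
  by have := dpair_neq_dsigma (y, Ad t y) (t * x, x * t^-1); rewrite -e eqxx.
by rewrite !embed_notin // => /mulgI/dpair_inj[/mulgI].
Qed.

Lemma embed_sub : embed G0 t @: G \subset dbl G0.
Proof.
case/setDP: Gt => Gt' G0't.
apply/subsetP=> _ /imsetP[x Gx ->].
have [G0x | G0'x] := boolP (x \in G0).
  rewrite embed_in // -[dpair _]mulg1.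
  apply: mem_mulg; last by rewrite !inE eqxx.
  apply/imset_f/setXP; split=> //=.
  have Gx' := subsetP sG0G x G0x.
  by rewrite /Ad !index2_mulG ?groupM ?groupV // G0x (negPf G0't).
rewrite embed_notin // dsigmaE; apply: mem_mulg; last by rewrite !inE eqxx orbT.
apply/imset_f/setXP; split=> /=.
  by rewrite index2_mulG ?groupV // (negPf G0't) (negPf G0'x).
by rewrite index2_mulG // (negPf G0't) (negPf G0'x).
Qed.

End Embedding.
End Double.

(* Main.v *)
(** The only element of [embed G0 t @: G] in [dleft G0] is [1], and
    [dbl G0 = dleft G0 * embed G0 t @: G]. Dedekind's modular law therefore gives
    [G' = (G' :&: dleft G0) * embed G0 t @: G] for every intermediate group [G'],
    hence uniqueness, and shows that [dleft K * embed G0 t @: G] meets [dleft G0]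
    in [dleft K]. Elements outside [G0] do not normalise [dleft G0], but they
    conjugate [(k, 1)] to [(1, Ad t k')] with [k' = Ad x k], which is
    [(k', 1)^-1] times the image of [k']. *)
Require Import Defs.
From mathcomp Require Import all_boot all_fingroup.
(* perm.v also defines a [dpair]. *)
Import Defs GroupScope.

Set Implicit Arguments.
Unset Strict Implicit.
Unset Printing Implicit Defensive.

Lemma dleftP (gT : finGroupType) (K : {set gT}) (u : dblT gT) :
  reflect (exists2 k, k \in K & u = dpair (k, 1)) (u \in dleft K).
Proof. exact: imsetP. Qed.

Lemma mem_dleft (gT : finGroupType) (K : {set gT}) (k : gT) :
  (dpair (k, 1) \in dleft K) = (k \in K).
Proof.
by apply: (mem_imset (f := fun k => dpair (k, 1))) => x y /dpair_inj[].
Qed.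

(** This is what makes [K] unique for a given [G']. *)
Lemma dleft_inj (gT : finGroupType) : injective (@dleft gT).
Proof. by move=> K H eKH; apply/setP=> k; rewrite -(mem_dleft K) eKH mem_dleft. Qed.

Lemma dleftS (gT : finGroupType) (K H : {set gT}) :
  K \subset H -> dleft K \subset dleft H.
Proof. exact: imsetS. Qed.

Lemma dpairlM (gT : finGroupType) (x y : gT) :
  dpair (x, 1) * dpair (y, 1) = dpair (x * y, 1).
Proof. by rewrite -dpairM; congr dpair; congr (_, _); rewrite /= mulg1. Qed.

Lemma dpairlV (gT : finGroupType) (x : gT) :
  (dpair (x, 1))^-1 = dpair (x^-1, 1).
Proof. by apply/eqP; rewrite eq_invg_mul dpairlM mulgV dpair1. Qed.

Lemma dleft_group_set (gT : finGroupType) (K : {group gT}) :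
  group_set (dleft K).
Proof.
apply/group_setP; split; first by rewrite -dpair1 mem_dleft.
move=> _ _ /dleftP[x Kx ->] /dleftP[y Ky ->].
by rewrite dpairlM mem_dleft groupM.
Qed.

Canonical dleft_group (gT : finGroupType) (K : {group gT}) :=
  Group (dleft_group_set K).

Section IntermediateGroups.

Variables (gT : finGroupType) (G G0 : {group gT}) (t : gT).
Hypotheses (sG0G : G0 \subset G) (iG0 : #|G : G0| = 2) (Gt : t \in G :\: G0).

Lemma mem_Ad (H : {group gT}) x k :
  H <| G -> x \in G -> (Ad x k \in H) = (k \in H).
Proof.
case/andP=> _ /subsetP nHG Gx.
by rewrite /Ad -mulgA -{1}[x]invgK -conjgE memJ_norm // groupV nHG.
Qed.

Lemma embed_group_set : group_set (embed G0 t @: G).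
Proof.
rewrite -(morphimEdom (Morphism (embedM t sG0G iG0))).
exact: groupP.
Qed.

Definition embed_group := Group embed_group_set.

(** Both cases keep the shape of a [dleft] element times an [embed] element. The rule thus serves
    twice: to show that [dleft K] times the image of [G] is a group, and to show that [K] is
    normal. *)
Lemma embed_dleftE x k : x \in G -> k \in G0 ->
  embed G0 t x * dpair (k, 1) =
    if x \in G0 then dpair (Ad x k, 1) * embed G0 t x
    else (dpair (Ad x k, 1))^-1 * embed G0 t (Ad x k * x).
Proof.
move=> Gx G0k; have nG0 : G0 <| G by apply: index2_normal.
have G0kx : Ad x k \in G0 by rewrite mem_Ad.
case: ifP => [G0x | /negbT G0'x].
  by rewrite embed_in // -!dpairM /Ad; congr dpair; congr (_, _);
    rewrite /= ?mulg1 ?mul1g ?mulgVK.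
have Gkx : Ad x k \in G := subsetP sG0G _ G0kx.
rewrite dpairlV (embedM t sG0G iG0) // (embed_in t G0kx) embed_notin //.
rewrite mulgA -dpairM [RHS]mulgA dpair_sigma -!mulgA -!dpairM /Ad.
by congr (_ * dpair _); congr (_, _);
  rewrite /= ?mulVg ?mulg1 ?mul1g ?mulgA ?mulgVK.
Qed.

(** For [x] in [G0] the second coordinate [Ad t x] must be [1], which forces [x = 1]. Outside [G0]
    the image lies in the [dsigma] coset, which contains no [dpair]. *)
Lemma embed_dleft_TI : embed G0 t @: G :&: dleft G0 = 1.
Proof.
apply/(@trivgP _ (embed_group :&: dleft_group G0)%G)/subsetP=> u /setIP[/imsetP[x Gx ->] /dleftP[k _]].
have [G0x | G0'x] := boolP (x \in G0).
  rewrite embed_in // => /dpair_inj[_ /(canRL (mulgK _))].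
  rewrite mul1g invgK -{2}[t]mulg1 => /mulgI ->.
  by rewrite /Ad mulg1 mulgV dpair1 set11.
by rewrite embed_notin // => e; have /eqP[] := dpair_neq_dsigma (k, 1) (t * x, x * t^-1).
Qed.

Lemma dbl_sub_dleft_embed : dbl G0 \subset dleft G0 * embed G0 t @: G.
Proof.
have sub1 p : p \in setX G0 G0 -> dpair p \in dleft G0 * embed G0 t @: G.
  case: p => a b /setXP[/= G0a G0b].
  have [Gt' _] := setDP Gt.
  have nG0 : G0 <| G by apply: index2_normal.
  have G0bt : Ad t^-1 b \in G0 by rewrite mem_Ad ?groupV.
  (* The element [Ad t^-1 b] is chosen so that its image has second coordinate [b]; a factor from
     [dleft G0] then corrects the first coordinate. *)
  have -> : dpair (a, b)
      = dpair (a * (Ad t^-1 b)^-1, 1) * embed G0 t (Ad t^-1 b).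
    rewrite embed_in // -dpairM; congr dpair; congr (_, _).
      by rewrite /= mulgVK.
    by rewrite /Ad /= mul1g !mulgA mulgV mul1g invgK mulgK.
  apply: mem_mulg; first by rewrite mem_dleft groupM // groupV.
  by rewrite imset_f // (subsetP sG0G).
apply/subsetP=> _ /mulsgP[_ s /imsetP[p G0p ->] /set2P[]-> ->].
  by rewrite mulg1 sub1.
have [Gt' G0't] := setDP Gt.
have G0t2 : t ^+ 2 \in G0.
  by rewrite expgS expg1 (index2_mulG sG0G iG0 Gt') // eqxx.
(* Since [embed G0 t t] is [dpair (1, t ^+ 2) * dsigma], it can absorb [dsigma], which reduces this
   coset to [sub1]. *)
have -> : dpair p * dsigma gT = dpair (p * (1, (t ^+ 2)^-1)) * embed G0 t t.
  rewrite (embed_tau' Gt) mulgA -dpairM; congr (dpair _ * _).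
  by case: p {G0p} => a b; congr (_, _); rewrite /= ?mulg1 ?mulgVK.
have Et : embed G0 t t \in embed G0 t @: G by rewrite imset_f.
(* Writing the image of [G] as its own square makes room for the extra factor [embed G0 t t]. *)
rewrite -(mulGid embed_group) mulgA mem_mulg //; apply: sub1.
by rewrite groupM //; apply/setXP; rewrite /= groupV G0t2 group1.
Qed.

Lemma intermediateE (H : {group dblT gT}) :
  embed G0 t @: G \subset H -> H \subset dbl G0 ->
  H :=: (H :&: dleft G0) * embed G0 t @: G.
Proof.
move=> sEH sHd; rewrite group_modr //; symmetry; apply/setIidPl.
exact: subset_trans dbl_sub_dleft_embed.
Qed.

Lemma dleft_embed_group_set (K : {group gT}) : K \subset G0 -> K <| G ->
  group_set (dleft K * embed G0 t @: G).
Proof.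
move=> sKG0 nKG; have sKG := subset_trans sKG0 sG0G.
have sEK : embed G0 t @: G * dleft K \subset dleft K * embed G0 t @: G.
  apply/subsetP=> _ /mulsgP[_ _ /imsetP[x Gx ->] /dleftP[k Kk ->] ->].
  have Kkx : Ad x k \in K by rewrite mem_Ad.
  rewrite (embed_dleftE Gx (subsetP sKG0 k Kk)).
  case: ifP => _; rewrite mem_mulg ?groupV ?mem_dleft ?imset_f //.
  by rewrite groupM // (subsetP sKG).
apply/(@comm_group_setP _ (dleft_group K) embed_group); apply/eqP.
(* The reverse inclusion is [sEK] after taking inverses. *)
rewrite /commute eqEsubset sEK -invSg !invMg.
by rewrite (invGid (dleft_group K)) (invGid embed_group) sEK.
Qed.

(** This pullback along [k] to [(k, 1)] is the [K] attached to an intermediate group [H]. *)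
Lemma dleft_pullback_group_set (H : {group dblT gT}) :
  group_set [set k in G0 | dpair (k, 1) \in H].
Proof.
apply/group_setP; split; first by rewrite inE group1 dpair1 group1.
move=> x y /setIdP[G0x Hx] /setIdP[G0y Hy].
by rewrite inE groupM // -dpairlM groupM.
Qed.

Lemma dleft_pullbackE (H : {group dblT gT}) :
  dleft [set k in G0 | dpair (k, 1) \in H] = H :&: dleft G0.
Proof.
apply/setP=> u; apply/dleftP/setIP=> [[k /setIdP[G0k Hk] ->] | [Hu]].
  by rewrite mem_dleft.
by case/dleftP=> k G0k eu; exists k; rewrite // inE G0k -eu.
Qed.

Lemma dleft_pullback_normal (H : {group dblT gT}) (K : {group gT}) :
  embed G0 t @: G \subset H -> K \subset G0 -> dleft K = H :&: dleft G0 ->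
  K <| G.
Proof.
move=> /subsetP sEH sKG0 eK; have nG0 : G0 <| G by apply: index2_normal.
rewrite /normal (subset_trans sKG0) //; apply/subsetP=> x Gx.
(* Passing to [x^-1] turns the conjugate of [k] into [Ad x k]. *)
rewrite -groupV inE; apply/subsetP=> _ /imsetP[k Kk ->].
have G0k := subsetP sKG0 k Kk.
have G0kx : Ad x k \in G0 by rewrite mem_Ad.
have -> : k ^ x^-1 = Ad x k by rewrite conjgE invgK mulgA.
rewrite -mem_dleft eK inE mem_dleft G0kx andbT.
have /setIP[Hk _] : dpair (k, 1) \in H :&: dleft G0 by rewrite -eK mem_dleft.
have HE y : y \in G -> embed G0 t y \in H by move=> Gy; rewrite sEH ?imset_f.
(* In both cases the right-hand [embed] factor lies in [H]; cancelling it leaves [(Ad x k, 1)] or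
   its inverse in [H]. *)
have := groupM (HE x Gx) Hk; rewrite embed_dleftE //.
case: ifP => _; rewrite groupMr ?groupV ?HE //.
by rewrite groupM // (subsetP sG0G).
Qed.

End IntermediateGroups.

Theorem theorem2 (gT : finGroupType) (G G0 : {group gT}) (t : gT)
    (sG0G : G0 \subset G) (iG0 : #|G : G0| = 2) (Gt : t \in G :\: G0) :
  (forall G' : {group dblT gT},
     embed G0 t @: G \subset G' -> G' \subset dbl G0 ->
     (exists! K : {group gT}, K \subset G0 /\ dleft K = G' :&: dleft G0) /\
     (forall K : {group gT},
        K \subset G0 -> dleft K = G' :&: dleft G0 -> K <| G)) /\
  (forall K : {group gT}, K \subset G0 -> K <| G ->
     exists! GK : {group dblT gT},
       [/\ embed G0 t @: G \subset GK, GK \subset dbl G0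
         & GK :&: dleft G0 = dleft K]).
Proof.
split=> [H sEH sHd | K sKG0 nKG].
  split=> [|K]; last exact: (dleft_pullback_normal sG0G iG0 sEH).
  exists (Group (dleft_pullback_group_set G0 H)); split=> [|K [_ eK]].
    by split; [apply/subsetP=> k /setIdP[] | apply: dleft_pullbackE].
  by apply/val_inj/dleft_inj; rewrite /= eK dleft_pullbackE.
exists (Group (dleft_embed_group_set t sG0G iG0 sKG0 nKG)).
split=> [|H [sEH sHd eH]]; last first.
  by apply/val_inj; rewrite /= (intermediateE sG0G iG0 Gt sEH sHd) eH.
have sEd := embed_sub sG0G iG0 Gt.
split=> /=.
- exact: (mulG_subr (dleft_group K)).
(* With [dbl G0] written as its own square, the two factors can be bounded separately. *)
- rewrite -(mulGid (dbl_group G0)) mulgSS //; apply/subsetP=> _ /dleftP[k Kk ->].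
  rewrite -[dpair _]mulg1 mem_mulg ?set21 // imset_f //.
  by apply/setXP; rewrite /= (subsetP sKG0) // group1.
rewrite -(@group_modl _ (dleft_group K) _ (dleft_group G0)) ?dleftS //.
by rewrite embed_dleft_TI ?mulg1.
Qed.
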